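(* Let $n\ge 2$ be an integer and let $A\subset [0,1]^n$ be a measurable, piecewise monotone $n$-de Bruijn-Erdős-set. Then $\dim_H(A)\le 1$ and \[\mathcal{H}^1(A) \leq n-1.\]
   Context: For a positive integer $n\ge 2$, an $n$-de Bruijn-Erdős-set ($n$-dBE-set) is a measurable set $A\subset [0,1]^n$ such that for any two distinct points $\mathbf{x}=(x_1,\ldots, x_n)$ and $\mathbf{y} = (y_1,\ldots,y_n)$ in $A$ there exists a unique $i\in \{1,\ldots,n\}$ with $x_i=y_i$. A monotone function means a function that is either strictly increasing or strictly decreasing. An injective, measurable function $f:[0,1]\to[0,1]$ is called piecewise monotone if there exists a countable partition of $[0,1]$ into disjoint measurable sets $\{S_j\}_{j\ge 1}$ such that for every $j$ the restriction of $f$ to $S_j$ is a monotone function. An $n$-dBE-set $A$ is called piecewise monotone if it is of the form \[A=\{(x,f_1(x),\ldots,f_{n-2}(x),\alpha): x\in [0,1]\},\] where $\alpha\in [0,1]$ is fixed and each function $f_i:[0,1]\to[0,1]$, $i\in\{1,\ldots,n-2\}$, is (injective, measurable and) piecewise monotone. For $A\subset\mathbb{R}^n$, $s>0$ and $\delta>0$, let $\mathcal{H}_{\delta}^{s}(A) = \inf \{ \sum_{i}\operatorname{diam}(U_i)^s: A \subset \bigcup_i U_i,\ \operatorname{diam}(U_i)\le \delta \}$, the infimum being over at most countable covers of $A$ (diameter with respect to the Euclidean distance). The $s$-dimensional Hausdorff measure is $\mathcal{H}^s(A)=\lim_{\delta\to 0_+}\mathcal{H}^s_\delta(A)$ (no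 normalizing constant), and $\dim_H(A)=\inf\{s:\mathcal{H}^s(A)=0\}$. *)

(* Defs.v *)
From HB Require Import structures.
From mathcomp Require Import all_boot all_order all_algebra.
From mathcomp Require Import all_classical all_reals all_analysis.

Set Implicit Arguments.
Unset Strict Implicit.
Unset Printing Implicit Defensive.

Import Order.TTheory GRing.Theory Num.Theory.
Import numFieldNormedType.Exports.

Local Open Scope classical_set_scope.
Local Open Scope ring_scope.

(* The norm that the library puts on row vectors is the sup norm, hence this
   explicit Euclidean distance. *)
Definition edist (R : realType) (n : nat) (x y : 'rV[R]_n) : R :=
  Num.sqrt (\sum_(i < n) (x ord0 i - y ord0 i) ^+ 2).

(* The point 0 is added so that the empty set has diameter 0 and not -oo. *)
Definition ediam (R : realType) (n : nat) (U : set 'rV[R]_n) : \bar R :=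
  ereal_sup (0%E |` [set (edist p.1 p.2)%:E | p in U `*` U]).

(* Covers are sequences; a finite cover is padded with empty sets, each of which
   contributes 0 to the sum as s > 0. *)
Definition hausdorff_delta (R : realType) (n : nat) (s delta : R)
    (A : set 'rV[R]_n) : \bar R :=
  ereal_inf [set (\sum_(0 <= i <oo) (ediam (U i) `^ s))%E
    | U in [set U : (set 'rV[R]_n)^nat |
             A `<=` \bigcup_i U i /\ forall i, (ediam (U i) <= delta%:E)%E]].

Definition hausdorff_measure (R : realType) (n : nat) (s : R)
    (A : set 'rV[R]_n) : \bar R :=
  lim (hausdorff_delta s delta A @[delta --> 0^'+]).

Definition hausdorff_dim (R : realType) (n : nat) (A : set 'rV[R]_n) : \bar R :=
  ereal_inf [set s%:E | s in [set s : R | 0 < s /\ hausdorff_measure s A = 0%E]].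

(* The topology of 'rV[R]_n is the product topology. *)
Definition borel_set (R : realType) (n : nat) (A : set 'rV[R]_n) : Prop :=
  <<s [set U : set 'rV[R]_n | open U] >> A.

Definition dBE_set (R : realType) (n : nat) (A : set 'rV[R]_n) : Prop :=
  [/\ borel_set A,
      forall x, A x -> forall i : 'I_n, 0 <= x ord0 i <= 1
    & forall x y, A x -> A y -> x <> y ->
        exists! i : 'I_n, x ord0 i = y ord0 i].

Definition strictly_monotone_on (R : realType) (S : set R) (f : R -> R) : Prop :=
  (forall x y, S x -> S y -> x < y -> f x < f y) \/
  (forall x y, S x -> S y -> x < y -> f y < f x).

(* Functions [0,1] -> [0,1] are represented by functions R -> R whose values
   outside [0,1] are irrelevant.  Measurability is with respect to the Borel
   sigma-algebra: with Lebesgue measurable f and S j, an increasing restriction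
   of f can send a null set onto a non-measurable set, and the graph of f can
   have infinite length.  Pieces of the partition may be empty, which accounts
   for finite partitions. *)
Definition piecewise_monotone_fun (R : realType) (f : R -> R) : Prop :=
  [/\ set_fun `[0, 1] `[0, 1] f,
      set_inj `[0, 1] f,
      measurable_fun (`[0, 1] : set R) f
    & exists S : (set R)^nat,
        [/\ forall j, measurable (S j),
            trivIset setT S,
            \bigcup_j S j = `[0, 1]%classic
          & forall j, strictly_monotone_on (S j) f]].

(* The point (x, f_1(x), ..., f_(n-2)(x), alpha); the coordinates are numbered
   from 0 to n-1, and only f 1, ..., f (n-2) are used. *)
Definition graph_point (R : realType) (n : nat) (f : nat -> R -> R) (alpha x : R)
    : 'rV[R]_n :=
  \row_(i < n) if i == 0 :> nat then x
               else if i == n.-1 :> nat then alpha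
               else f i x.

Definition piecewise_monotone_set (R : realType) (n : nat)
    (A : set 'rV[R]_n) : Prop :=
  exists (f : nat -> R -> R) (alpha : R),
    [/\ 0 <= alpha <= 1,
        forall i : nat, (1 <= i <= n - 2)%N -> piecewise_monotone_fun (f i)
      & A = [set graph_point n f alpha x | x in `[0, 1]%classic]].

(* Main.v *)
Require Import Defs.
From mathcomp Require Import all_boot all_order all_algebra.
From mathcomp Require Import all_classical all_reals all_analysis.
From mathcomp Require Import measurable_realfun.

(** The set A is the image of [0, 1] under a map F whose n - 1 nonconstant
coordinates h_1, ..., h_(n-1) (the identity and the f_i) are injective, piecewise
monotone functions from [0, 1] to [0, 1].  Where all the h_i are monotone, F
draws a curve with monotone coordinates, possibly full of holes, and the length
of such a curve is at most the sum of the lengths of its projections to the axes.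
Each projection of A is injective, hence the projections of the monotone parts
do not overlap and have total length at most 1 on each of the n - 1 axes.

The bound for one monotone part F(T) is [hausdorff_delta_monotone_graph].  It
must involve the measures of the h_i(T) and not the lengths of their hulls, as T
may be any Borel set; this is why the covers of F(T) come from open
neighbourhoods of the projections.  The coordinates are compared with distances
through the inequality between the Euclidean and the l1 distance.

To sum over the countably many parts one needs the h_i(T_k) to be measurable,
which holds because the inverse of a monotone function extends to a monotone
function on the line ([measurable_image_monotone]), and the countable
subadditivity of the size-delta Hausdorff content
([hausdorff_delta_sigma_subadditive]).  This gives the bound n - 1 for the content
at every scale delta ([hausdorff_delta_piecewise_monotone]), and therefore the
bound for the Hausdorff measure.  A bound that is uniform in delta also forces
the s-dimensional measure to vanish for s > 1 ([hausdorff_measure_gt1_eq0]), so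
the dimension is at most 1. *)

Import Order.TTheory GRing.Theory Num.Theory.
Import numFieldNormedType.Exports.

Local Open Scope classical_set_scope.
Local Open Scope ring_scope.

(** * Common refinements of countable families *)

(** The common refinement of m countable families of sets, numbered by [nat]
through the countability of the type of multi-indices. *)
Definition refinement (T : Type) (m : nat) (P : 'I_m -> nat -> set T) (k : nat)
    : set T :=
  [set x | exists g : {ffun 'I_m -> nat}, pickle g = k /\ forall i, P i (g i) x].

Lemma trivIset_refinement (T : Type) (m : nat) (P : 'I_m -> nat -> set T) :
  (forall i, trivIset setT (P i)) -> trivIset setT (refinement T m P).
Proof.
move=> tP k l _ _ [x [[g [gk Pg]] [g' [g'l Pg']]]].
rewrite -gk -g'l; congr pickle; apply/ffunP => i.
by apply: (tP i) => //; exists x.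
Qed.

Lemma refinement_cover (T : Type) (m : nat) (P : 'I_m -> nat -> set T) (x : T) :
  (forall i, exists j, P i j x) -> exists k, refinement T m P k x.
Proof.
move=> /choice[j Pj]; exists (pickle [ffun i => j i]), [ffun i => j i].
by split=> // i; rewrite ffunE.
Qed.

Lemma refinement_same (T : Type) (m : nat) (P : 'I_m -> nat -> set T) (k : nat)
    (x y : T) (i : 'I_m) :
  refinement T m P k x -> refinement T m P k y -> exists j, P i j x /\ P i j y.
Proof.
move=> [g [gk Pg]] [g' [g'k Pg']]; exists (g i); split; first exact: Pg.
suff -> : g = g' by exact: Pg'.
by apply: (pcan_inj pickleK); rewrite gk g'k.
Qed.

Lemma measurable_refinement (d : measure_display) (T : measurableType d) (m : nat)
    (P : 'I_m -> nat -> set T) (k : nat) :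
  (forall i j, measurable (P i j)) -> measurable (refinement T m P k).
Proof.
move=> mP.
have [[g gk]|ng] := pselect (exists g : {ffun 'I_m -> nat}, pickle g = k); last first.
  rewrite (_ : refinement _ _ _ _ = set0); first exact: measurable0.
  by apply/seteqP; split=> // x [g [gk _]]; apply: ng; exists g.
rewrite (_ : refinement _ _ _ _ = \bigcap_(i in [set: 'I_m]) P i (g i)).
  by apply: fin_bigcap_measurable => // i _; exact: mP.
apply/seteqP; split=> x /=.
- move=> [g' [g'k Pg']] i _; suff -> : g = g' by exact: Pg'.
  by apply: (pcan_inj pickleK); rewrite g'k gk.
- by move=> Px; exists g; split=> // i; exact: Px.
Qed.

(** * Strictly monotone functions on subsets of the line *)

Lemma strictly_monotone_onS (R : realType) (S T : set R) (f : R -> R) :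
  T `<=` S -> strictly_monotone_on S f -> strictly_monotone_on T f.
Proof.
by move=> TS [mf|mf]; [left|right] => x y Tx Ty; apply: mf; exact: TS.
Qed.

Lemma strictly_monotone_between (R : realType) (T : set R) (f : R -> R) (x y z : R) :
  strictly_monotone_on T f -> T x -> T y -> T z -> x <= z <= y ->
  f x <= f z <= f y \/ f y <= f z <= f x.
Proof.
move=> mf Tx Ty Tz /andP[xz zy].
have weak g : (forall a b, T a -> T b -> a < b -> g a < g b) ->
    forall a b, T a -> T b -> a <= b -> g a <= g b :> R.
  move=> mg a b Ta Tb; rewrite le_eqVlt => /orP[/eqP ->//|ab].
  by rewrite ltW// mg.
case: mf => mf; [left|right]; first by rewrite !(weak f).
have mNf : forall a b, T a -> T b -> a < b -> - f a < - f b.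
  by move=> a b Ta Tb ab; rewrite ltrN2 mf.
by apply/andP; split; rewrite -lerN2; apply: (weak (fun u => - f u)).
Qed.

(** The generalised inverse psi y = sup {x in T | f x <= y} is defined and
nondecreasing, hence Borel, on the whole line, and psi (f x) = x on T.  So f(T)
is the set of the y with psi y in T and f (psi y) = y, which is Borel.  This
elementary argument replaces the theorem of Lusin and Souslin on injective Borel
images. *)
Lemma measurable_image_increasing (R : realType) (T : set R) (f : R -> R) :
  measurable T -> T `<=` `[0, 1]%classic -> measurable_fun T f ->
  (forall x y, T x -> T y -> x < y -> f x < f y) ->
  measurable (f @` T).
Proof.
move=> mT T01 mf fi.
pose psi y := sup [set x | T x /\ f x <= y].
have ubT y : has_ubound [set x | T x /\ f x <= y].
  by exists 1 => x [/T01]; rewrite /= in_itv/= => /andP[].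
have psi_nd : nondecreasing_fun psi.
  move=> y y' yy'; have [E|/set0P[x xT]] := eqVneq [set x | T x /\ f x <= y] set0.
    (* The supremum of the empty set is 0, a lower bound of T. *)
    rewrite {1}/psi E sup0.
    have [E'|/set0P[x xT]] := eqVneq [set x | T x /\ f x <= y'] set0.
      by rewrite /psi E' sup0.
    apply: le_trans (ub_le_sup _ xT) => //.
    by have [/T01] := xT; rewrite /= in_itv/= => /andP[].
  apply: ge_sup; first by exists x.
  move=> z [Tz fz]; apply: ub_le_sup => //=; split=> //; exact: le_trans yy'.
have psiK x : T x -> psi (f x) = x.
  move=> Tx; apply/eqP; rewrite eq_le; apply/andP; split.
    apply: ge_sup; first by exists x.
    move=> z [Tz fz]; rewrite leNgt; apply/negP => xz.
    by have := fi _ _ Tx Tz xz; rewrite ltNge fz.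
  by apply: ub_le_sup.
have mpsi : measurable_fun setT psi by exact: nondecreasing_measurable.
have mD : measurable (psi @^-1` T) by rewrite -[X in measurable X]setTI; exact: mpsi.
have mE : measurable_fun (psi @^-1` T) (fun y => f (psi y) == y).
  apply: measurable_fun_eqr; last exact: measurable_id.
  apply: (measurable_comp mT _ mf); first by move=> _ [y ? <-].
  exact: measurable_funTS.
rewrite (_ : f @` T = psi @^-1` T `&` (fun y => f (psi y) == y) @^-1` [set true]).
  exact: mE.
apply/seteqP; split=> y /=.
  by move=> [x Tx <-]; rewrite psiK//; split=> //; exact/eqP.
by move=> [Ty /eqP fy]; exists (psi y).
Qed.

Lemma measurable_image_monotone (R : realType) (T : set R) (f : R -> R) :
  measurable T -> T `<=` `[0, 1]%classic -> measurable_fun T f ->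
  strictly_monotone_on T f -> measurable (f @` T).
Proof.
move=> mT T01 mf [fi|fd]; first exact: measurable_image_increasing.
have mN : measurable ((\- f) @` T).
  apply: measurable_image_increasing => //; first exact: measurable_funN.
  by move=> x y Tx Ty xy /=; rewrite ltrN2 fd.
rewrite (_ : f @` T = setT `&` -%R @^-1` ((\- f) @` T)).
  by apply: (measurable_funN (@measurable_id _ _ setT)).
apply/seteqP; split=> y /=.
  by move=> [x Tx <-]; split=> //; exists x.
by move=> [_ [x Tx /oppr_inj fx]]; exists x.
Qed.

(** * Intervals and order hulls *)

(** The components of U are disjoint intervals of unbounded length; intersecting
them with the cells of a grid of mesh eta makes them short and keeps them
disjoint, so no length is counted twice. *)
Lemma open_disjoint_short_itv (R : realType) (U : set R) (eta : R) :
  open U -> 0 < eta ->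
  exists J : nat -> set R,
    [/\ forall k, is_interval (J k), trivIset setT J, U = \bigcup_k J k
      & forall k x y, J k x -> J k y -> `|x - y| <= eta].
Proof.
move=> oU eta0; pose I := open_disjoint_itv oU.
exists (fun k => [set x | exists p : nat * int,
  [/\ pickle p = k, I p.1 x & Num.floor (x / eta) = p.2]]); split.
- move=> k x y [p [pk Ix fx]] [q [qk Iy fy]] z /andP[xz zy].
  have pq : q = p by apply: (pcan_inj pickleK); rewrite pk qk.
  subst q; exists p; split=> //.
    by apply: (open_disjoint_itv_is_interval Ix Iy); rewrite xz zy.
  apply/eqP; rewrite eq_le -{1}fy -fx !le_floor//.
    by rewrite ler_pM2r ?invr_gt0.
  by rewrite ler_pM2r ?invr_gt0.
- move=> k l _ _ [x [[p [pk Ix fx]] [q [ql Iy fy]]]].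
  rewrite -pk -ql; congr pickle; rewrite (surjective_pairing p) (surjective_pairing q).
  rewrite -fx -fy; congr pair.
  by apply: (open_disjoint_itv_trivIset (oU := oU)) => //; exists x.
- rewrite {1}(open_disjoint_itv_bigcup oU); apply/seteqP; split=> x.
  + move=> [j _ Ix].
    by exists (pickle (j, Num.floor (x / eta))) => //; exists (j, Num.floor (x / eta)).
  + by move=> [k _ [p [_ Ix _]]]; exists p.1.
- move=> k x y [p [pk Ix fx]] [q [qk Iy fy]].
  have pq : q = p by apply: (pcan_inj pickleK); rewrite pk qk.
  subst q.
  have := floor_itv (x / eta); have := floor_itv (y / eta).
  rewrite fx fy => /andP[]; rewrite ler_pdivlMr// ltr_pdivrMr// => a b.
  move=> /andP[]; rewrite ler_pdivlMr// ltr_pdivrMr// => c d.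
  move: b d; rewrite intrD mulrDl mul1r => b d.
  rewrite ler_distl; apply/andP; split.
    by rewrite lerBlDr ltW// (lt_le_trans b)// lerD2r.
  by rewrite ltW// (lt_le_trans d)// lerD2r.
Qed.

(** Working with all the points between two points of B, rather than with an
interval whose ends are inf B and sup B, avoids infinite ends and makes
disjointness of hulls a matter of comparing points. *)
Definition order_hull (R : realType) (B : set R) : set R :=
  [set y | exists a b, [/\ B a, B b & a <= y <= b]].

Lemma measurable_order_hull (R : realType) (B : set R) : measurable (order_hull R B).
Proof.
apply: is_interval_measurable => x y [a [_ [Ba _ /andP[ax _]]]].
move=> [_ [b [_ Bb /andP[_ yb]]]] z /andP[xz zy].
by exists a, b; rewrite (le_trans ax xz) (le_trans zy yb).
Qed.

Lemma dist_le_order_hull (R : realType) (B : set R) (a b : R) :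
  B a -> B b -> (`|a - b|%:E <= lebesgue_measure (order_hull R B))%E.
Proof.
wlog ab : a b / a <= b.
  move=> H Ba Bb; case: (leP a b) => [|/ltW] ab; first exact: H.
  by rewrite distrC; exact: H.
move=> Ba Bb; have <- : lebesgue_measure (`[a, b]%classic : set R) = (`|a - b|%:E)%E.
  rewrite distrC ger0_norm ?subr_ge0// lebesgue_measure_itv/= lte_fin.
  move: ab; rewrite le_eqVlt => /orP[/eqP ->|->]; last by rewrite EFinB.
  by rewrite ltxx subrr.
apply: le_measure; rewrite ?inE//; first exact: measurable_order_hull.
by move=> y; rewrite /= in_itv/= => ayb; exists a, b.
Qed.

(** If two hulls share a point y, then f takes on C k values below and above y,
and likewise on C l.  Since f is strictly monotone, the two pairs of arguments
interlace, so one of the four arguments lies between two arguments of the other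
piece; by convexity it belongs to both pieces. *)
Lemma trivIset_order_hull (R : realType) (T : set R) (f : R -> R) (C : nat -> set R) :
  strictly_monotone_on T f -> trivIset setT C -> (forall k, C k `<=` T) ->
  (forall k x y z, C k x -> C k y -> T z -> x <= z <= y -> C k z) ->
  trivIset setT (fun k => order_hull R (f @` C k)).
Proof.
move=> mf tC CT cC k l _ _ [y [Hk Hl]].
move: Hk => [u [v [[a Ca <-] [b Cb <-]]]] /andP[ay yb].
move: Hl => [u' [v' [[a' Ca' <-] [b' Cb' <-]]]] /andP[ay' yb'].
have tkl z : C k z -> C l z -> k = l by move=> Ck Cl; apply: tC => //; exists z.
have [[[Ta Tb] Ta'] Tb'] := (CT _ _ Ca, CT _ _ Cb, CT _ _ Ca', CT _ _ Cb').
have fab' := le_trans ay yb'; have fa'b := le_trans ay' yb.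
case: mf => mf.
- have ab' : a <= b'.
    by rewrite leNgt; apply/negP => /(mf _ _ Tb' Ta); rewrite ltNge fab'.
  have a'b : a' <= b.
    by rewrite leNgt; apply/negP => /(mf _ _ Tb Ta'); rewrite ltNge fa'b.
  have [aa'|/ltW a'a] := leP a a'.
    by apply: (tkl a') => //; apply: (cC _ a b) => //; rewrite aa' a'b.
  by apply: (tkl a) => //; apply: (cC _ a' b') => //; rewrite a'a ab'.
- have b'a : b' <= a.
    by rewrite leNgt; apply/negP => /(mf _ _ Ta Tb'); rewrite ltNge fab'.
  have ba' : b <= a'.
    by rewrite leNgt; apply/negP => /(mf _ _ Ta' Tb); rewrite ltNge fa'b.
  have [bb'|/ltW b'b] := leP b b'.
    by apply: (tkl b') => //; apply: (cC _ b a) => //; rewrite bb' b'a.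
  by apply: (tkl b) => //; apply: (cC _ b' a') => //; rewrite b'b ba'.
Qed.

(** * Hausdorff contents and measures *)

Lemma ediam_ge0 (R : realType) (n : nat) (U : set 'rV[R]_n) : (0 <= ediam U)%E.
Proof. by apply: ereal_sup_ubound; left. Qed.

Lemma ediam_le (R : realType) (n : nat) (U : set 'rV[R]_n) (M : \bar R) :
  (0 <= M)%E -> (forall x y, U x -> U y -> ((Defs.edist x y)%:E <= M)%E) ->
  (ediam U <= M)%E.
Proof.
move=> M0 UM; apply: ge_ereal_sup => _ [->//|[[x y] [Ux Uy] <-]].
exact: UM.
Qed.

Lemma hausdorff_delta_ge0 (R : realType) (n : nat) (s delta : R) (A : set 'rV[R]_n) :
  (0 <= hausdorff_delta s delta A)%E.
Proof.
apply: le_ereal_inf_tmp => _ [U _ <-].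
by apply: nneseries_ge0 => k _ _; exact: poweR_ge0.
Qed.

Lemma hausdorff_delta_cover (R : realType) (n : nat) (s delta e : R)
    (A : set 'rV[R]_n) :
  (hausdorff_delta s delta A < +oo)%E -> 0 < e ->
  exists U : nat -> set 'rV[R]_n,
    [/\ A `<=` \bigcup_i U i, forall i, (ediam (U i) <= delta%:E)%E
      & (\sum_(0 <= i <oo) ediam (U i) `^ s <= hausdorff_delta s delta A + e%:E)%E].
Proof.
move=> fin e0.
have : hausdorff_delta s delta A \is a fin_num.
  by rewrite ge0_fin_numE// hausdorff_delta_ge0.
move=> /(lb_ereal_inf_adherent e0)[_ [U [AU dU] <-] lte].
by exists U; split=> //; exact: ltW.
Qed.

(** As for every outer measure built from covers: almost optimal covers of the
A k, with errors e / 2 ^ (k + 1), are merged into one sequence along a bijection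
between [nat] and [nat * nat]. *)
Lemma hausdorff_delta_sigma_subadditive (R : realType) (n : nat) (s delta : R)
    (A : nat -> set 'rV[R]_n) :
  (hausdorff_delta s delta (\bigcup_k A k)
     <= \sum_(0 <= k <oo) hausdorff_delta s delta (A k))%E.
Proof.
have H0 k := hausdorff_delta_ge0 _ _ s delta (A k).
have [[k Hk]|noo] := pselect (exists k, hausdorff_delta s delta (A k) = +oo%E).
  rewrite (eseries_pinfty _ _ Hk) ?leey// => j _.
  by rewrite -ltNye (lt_le_trans _ (H0 j)).
apply/lee_addgt0Pr => e e0.
apply: le_trans (epsilon_trick _ H0 (ltW e0)).
have /choice[U HU] : forall k, exists U : nat -> set 'rV[R]_n,
    [/\ A k `<=` \bigcup_i U i, forall i, (ediam (U i) <= delta%:E)%E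
      & (\sum_(0 <= i <oo) ediam (U i) `^ s
           <= hausdorff_delta s delta (A k) + (e / (2 ^ k.+1)%:R)%:E)%E].
  move=> k; apply: hausdorff_delta_cover; last by rewrite divr_gt0// ltr0n expn_gt0.
  by rewrite ltey; apply/eqP => Hk; apply: noo; exists k.
have /card_esym/card_set_bijP[/= p pbij] := card_nat2.
have p0 i j : (0 <= ediam (U i j) `^ s)%E by exact: poweR_ge0.
apply: (@le_trans _ _ (\sum_(0 <= i <oo) ediam (U (p i).1 (p i).2) `^ s)%E).
  apply: ereal_inf_lbound; exists (fun i => U (p i).1 (p i).2) => //; split.
    move=> x [k _ Ax]; have [AU _ _] := HU k; have [j _ Ux] := AU _ Ax.
    have [_ _ psurj] := pbij; have [i _ pi] := psurj (k, j) Logic.I.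
    by exists i => //; rewrite pi.
  by move=> i; have [_ dU _] := HU (p i).1.
apply: (@le_trans _ _ (\sum_(0 <= i <oo) \sum_(0 <= j <oo) ediam (U i j) `^ s)%E).
  rewrite nneseries_esumT// -(reindex_esum _ _ _ (fun q => ediam (U q.1 q.2) `^ s)%E pbij).
  rewrite nneseries_esumT; last by move=> i; exact: nneseries_ge0.
  under [leRHS]eq_esum do rewrite nneseries_esumT//.
  rewrite esum_esum//.
  rewrite (_ : setT `*`` (fun=> setT) = setT)//.
  by apply/seteqP; split.
apply: lee_nneseries => k; first by move=> _ _; exact: nneseries_ge0.
by move=> _; have [_ _] := HU k.
Qed.

Lemma hausdorff_delta_nonincreasing (R : realType) (n : nat) (s d d' : R) (A : set 'rV[R]_n) :
  d <= d' -> (hausdorff_delta s d' A <= hausdorff_delta s d A)%E.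
Proof.
move=> dd'; apply: ereal_inf_le_tmp => _ [U [AU dU] <-].
by exists U => //; split=> // i; apply: le_trans (dU i) _; rewrite lee_fin.
Qed.

(** The limit that defines the measure exists because a smaller delta allows
fewer covers. *)
Lemma hausdorff_measureE (R : realType) (n : nat) (s : R) (A : set 'rV[R]_n) :
  hausdorff_measure s A
  = ereal_sup [set hausdorff_delta s d A | d in `]0, +oo[%classic].
Proof.
apply: cvg_lim => //; apply: nonincreasing_at_right_cvge => // d d' _ _.
exact: hausdorff_delta_nonincreasing.
Qed.

Lemma poweR_le_scale (R : realType) (s delta : R) (d : \bar R) :
  1 < s -> 0 < delta -> (0 <= d)%E -> (d <= delta%:E)%E ->
  (d `^ s <= (delta `^ (s - 1))%:E * d `^ 1)%E.
Proof.
move=> s1 delta0; case: d => [d| |]//; rewrite lee_fin => d0; rewrite lee_fin => ddelta.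
rewrite !poweR_EFin -EFinM lee_fin.
have [->|dn0] := eqVneq d 0.
  by rewrite powR0 ?mulr_ge0 ?powR_ge0// gt_eqF// (lt_trans _ s1).
have -> : d `^ s = d `^ (s - 1) * d `^ 1.
  by rewrite -powRD ?dn0 ?implybT// subrK.
rewrite ler_wpM2r ?powR_ge0// ge0_ler_powR// ?nnegrE ?ltW//.
by rewrite subr_gt0.
Qed.

(** A set of diameter d <= delta satisfies d ^ s <= delta ^ (s - 1) * d, so a cover
of total length at most M + 1 has s-dimensional sum at most
delta ^ (s - 1) * (M + 1), which tends to 0 with delta. *)
Lemma hausdorff_measure_gt1_eq0 (R : realType) (n : nat) (s M : R) (A : set 'rV[R]_n) :
  1 < s -> 0 <= M ->
  (forall delta, 0 < delta -> (hausdorff_delta 1 delta A <= M%:E)%E) ->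
  hausdorff_measure s A = 0%E.
Proof.
move=> s1 M0 AM.
have bound delta : 0 < delta ->
    (hausdorff_delta s delta A <= (delta `^ (s - 1) * (M + 1))%:E)%E.
  move=> delta0.
  have fin : (hausdorff_delta 1 delta A < +oo)%E.
    exact: le_lt_trans (AM _ delta0) (ltry _).
  have [U [AU dU Us]] := hausdorff_delta_cover _ _ _ _ _ _ fin ltr01.
  apply: (@le_trans _ _ (\sum_(0 <= i <oo) ediam (U i) `^ s)%E).
    by apply: ereal_inf_lbound; exists U.
  apply: (@le_trans _ _ (\sum_(0 <= i <oo) (delta `^ (s - 1))%:E * ediam (U i) `^ 1)%E).
    apply: lee_nneseries => k; first by move=> _ _; exact: poweR_ge0.
    by move=> _; apply: poweR_le_scale => //; exact: ediam_ge0.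
  rewrite nneseriesZl; last by move=> k _; exact: poweR_ge0.
  rewrite EFinM lee_wpmul2l ?lee_fin ?powR_ge0//.
  by apply: le_trans Us _; rewrite EFinD leeD2r// AM.
have M1 : 0 < M + 1 by rewrite ltr_wpDl.
rewrite hausdorff_measureE; apply/eqP; rewrite eq_le; apply/andP; split.
  apply: ge_ereal_sup => _ [d + <-]; rewrite /= in_itv/= andbT => d0.
  apply/lee_addgt0Pr => e e0; rewrite add0e.
  (* At this scale delta ^ (s - 1) * (M + 1) equals e. *)
  pose r := (e / (M + 1)) `^ (s - 1)^-1.
  have r0 : 0 < r by rewrite powR_gt0// divr_gt0.
  have dr0 : 0 < Num.min d r by rewrite lt_min d0 r0.
  apply: le_trans (hausdorff_delta_nonincreasing _ _ _ (Num.min d r) _ _ _) _.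
    by rewrite ge_min lexx.
  apply: le_trans (bound _ dr0) _; rewrite lee_fin -ler_pdivlMr//.
  apply: (@le_trans _ _ (r `^ (s - 1))).
    apply: ge0_ler_powR; rewrite ?nnegrE ?(ltW r0) ?(ltW dr0)//.
      by rewrite ltW// subr_gt0.
    by rewrite ge_min lexx orbT.
  rewrite /r -powRrM mulVf ?subr_eq0 ?gt_eqF// powRr1//.
  by rewrite divr_ge0// ltW.
apply: (@le_trans _ _ (hausdorff_delta s 1 A)); first exact: hausdorff_delta_ge0.
by apply: ereal_sup_ubound; exists 1 => //=; rewrite in_itv/= ltr01.
Qed.

Lemma hausdorff_dim_le1 (R : realType) (n : nat) (M : R) (A : set 'rV[R]_n) :
  0 <= M -> (forall delta, 0 < delta -> (hausdorff_delta 1 delta A <= M%:E)%E) ->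
  (hausdorff_dim A <= 1%:E)%E.
Proof.
move=> M0 AM; apply/lee_addgt0Pr => e e0.
apply: ereal_inf_lbound; exists (1 + e) => //; split; first by rewrite addr_gt0.
by apply: (hausdorff_measure_gt1_eq0 _ _ _ M) => //; rewrite ltrDl.
Qed.

(** * Length of curves with monotone coordinates *)

(** Enclose each h_i(T) in an open set U_i of almost the same measure, and cut U_i
into disjoint short intervals.  Put two points of T in the same piece C if, for
each i, their values under h_i lie in the same interval of U_i.  As the h_i are
monotone, the pieces are convex relative to T, so for fixed i the hulls of the
h_i(C) are disjoint subsets of U_i, and their lengths add up to at most the
measure of U_i.  The diameter of F(C) is at most the sum over i of these lengths:
the projections are bounded separately although the pieces are common to all
of them. *)
Lemma hausdorff_delta_monotone_graph (R : realType) (n m : nat) (F : R -> 'rV[R]_n)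
    (h : 'I_m -> R -> R) (T : set R) (delta : R) :
  0 < delta ->
  (forall i, strictly_monotone_on T (h i)) ->
  (forall i, measurable (h i @` T)) ->
  (forall i, (lebesgue_measure (h i @` T) < +oo)%E) ->
  (forall x y, T x -> T y -> Defs.edist (F x) (F y) <= \sum_i `|h i x - h i y|) ->
  (hausdorff_delta 1 delta (F @` T) <= \sum_i lebesgue_measure (h i @` T))%E.
Proof.
move=> delta0 mh mhT hfin Fh; apply/lee_addgt0Pr => e e0.
(* The denominator is m + 1 so that m may be 0. *)
pose e' := e / m.+1%:R.
have e'0 : 0 < e' by rewrite divr_gt0.
have /choice[U HU] : forall i, exists U, [/\ open U, h i @` T `<=` U
    & (lebesgue_measure U <= lebesgue_measure (h i @` T) + e'%:E)%E].
  move=> i; have [U [oU TU Ue]] := lebesgue_regularity_outer (mhT i) (hfin i) e'0.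
  exists U; split=> //.
  have mU := open_measurable oU.
  have mUT := measurableD mU (mhT i).
  rewrite -{1}(setDUK TU); apply: le_trans (measureU2 lebesgue_measure (mhT i) mUT) _.
  by rewrite leeD2l// ltW.
pose eta := delta / m.+1%:R.
have eta0 : 0 < eta by rewrite divr_gt0.
have /choice[J HJ] : forall i, exists J : nat -> set R,
    [/\ forall k, is_interval (J k), trivIset setT J, U i = \bigcup_k J k
      & forall k x y, J k x -> J k y -> `|x - y| <= eta].
  by move=> i; apply: open_disjoint_short_itv => //; case: (HU i).
pose P i j := h i @^-1` J i j.
pose C k := T `&` refinement R m P k.
pose H i k := order_hull R (h i @` C k).
have CT k : C k `<=` T by move=> x [].
have tC : trivIset setT C.
  apply: trivIset_setIl; apply: trivIset_refinement => i k l _ _ [x [Px Px']].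
  by have [_ tJ _ _] := HJ i; apply: tJ => //; exists (h i x).
have cC k x y z : C k x -> C k y -> T z -> x <= z <= y -> C k z.
  move=> [Tx [g [gk Px]]] [Ty Cy] Tz xzy; split=> //.
  exists g; split=> // i.
  have [j [Jx Jy]] : exists j, P i j x /\ P i j y.
    by apply: refinement_same Cy; exists g.
  have [iJ tJ _ _] := HJ i.
  have -> : g i = j by apply: tJ => //; exists (h i x); split=> //; exact: Px.
  have [] := strictly_monotone_between _ _ _ _ _ _ (mh i) Tx Ty Tz xzy.
    exact: iJ.
  exact: iJ.
have tH i : trivIset setT (H i) by exact: (trivIset_order_hull _ T).
have mH i k : measurable (H i k) by exact: measurable_order_hull.
have mbH i : measurable (\bigcup_k H i k).
  by apply: bigcup_measurable => k _; exact: mH.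
have HUi i : \bigcup_k H i k `<=` U i.
  move=> y [k _ [_ [_ [[a [_ Ca] <-] [b [_ Cb] <-] ayb]]]].
  have [j [Ja Jb]] := refinement_same _ _ _ _ _ _ i Ca Cb.
  have [iJ _ -> _] := HJ i; exists j => //.
  exact: iJ Ja Jb _ ayb.
apply: (@le_trans _ _ (\sum_(0 <= k <oo) ediam (F @` C k) `^ 1)%E).
  apply: ereal_inf_lbound; exists (fun k => F @` C k) => //=; split.
    move=> _ [x Tx <-].
    have [k Ck] : exists k, refinement R m P k x.
      apply: refinement_cover => i; have [_ hU _] := HU i.
      have [_ _ UJ _] := HJ i.
      have : U i (h i x) by apply: hU; exists x.
      by rewrite UJ => -[j _ Jj]; exists j.
    by exists k => //; exists x.
  move=> k; apply: ediam_le; first by rewrite lee_fin ltW.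
  move=> _ _ [x [Tx Cx] <-] [y [Ty Cy] <-]; rewrite lee_fin.
  apply: (le_trans (Fh _ _ Tx Ty)).
  apply: (@le_trans _ _ (\sum_(i < m) eta)).
    apply: ler_sum => i _.
    have [j [Ja Jb]] := refinement_same _ _ _ _ _ _ i Cx Cy.
    by have [_ _ _ dJ] := HJ i; exact: dJ Ja Jb.
  rewrite sumr_const card_ord -mulr_natl /eta mulrCA ger_pMr//.
  by rewrite ler_pdivrMr// mul1r ler_nat.
apply: (@le_trans _ _ (\sum_(0 <= k <oo) \sum_i lebesgue_measure (H i k))%E).
  apply: lee_nneseries => k; first by move=> _ _; exact: poweR_ge0.
  rewrite poweRe1 ?ediam_ge0// => _.
  apply: ediam_le; first by apply: sume_ge0.
  move=> _ _ [x Cx <-] [y Cy <-].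
  have := Fh _ _ (CT _ _ Cx) (CT _ _ Cy).
  rewrite -lee_fin => /le_trans; apply.
  rewrite -sumEFin; apply: lee_sum => i _.
  by apply: dist_le_order_hull; [exists x|exists y].
rewrite nneseries_sum//.
apply: (@le_trans _ _ (\sum_i (lebesgue_measure (h i @` T) + e'%:E))%E).
  apply: lee_sum => i _.
  have [oU _ Ue] := HU i.
  apply: le_trans Ue.
  rewrite -measure_semi_bigcup//; [|exact: mH|exact: mbH].
  apply: le_measure; rewrite ?inE; [exact: mbH|exact: open_measurable|exact: HUi].
rewrite big_split/= leeD2l// sumEFin lee_fin sumr_const card_ord -mulr_natl.
by rewrite /e' mulrCA ger_pMr// ler_pdivrMr// mul1r ler_nat.
Qed.

(** The first coordinate of the graph is the identity, which can thus be treated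
like the other ones. *)
Lemma piecewise_monotone_id (R : realType) : piecewise_monotone_fun (@id R).
Proof.
split; [by []|by move=> x y _ _|exact: measurable_id|].
exists (fun k => if k is 0 then `[0, 1]%classic else set0); split.
- by case=> [|k]; [exact: measurable_itv|exact: measurable0].
- by case=> [|k] [|l] _ _ [x []].
- by apply/seteqP; split=> [x [[|k] _]|x x01] //; exists 0%N.
- by move=> k; left.
Qed.

(** On the common refinement (T_k) of the m partitions all the h_i are monotone,
so the bound for monotone graphs applies to each T_k.  For fixed i the sets
h_i(T_k) are disjoint because h_i is injective, and they are Borel, so that their
measures add up to the measure of a subset of [0, 1]. *)
Lemma hausdorff_delta_piecewise_monotone (R : realType) (n m : nat)
    (F : R -> 'rV[R]_n) (h : 'I_m -> R -> R) (delta : R) :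
  0 < delta -> (forall i, piecewise_monotone_fun (h i)) ->
  (forall x y, Defs.edist (F x) (F y) <= \sum_i `|h i x - h i y|) ->
  (hausdorff_delta 1 delta (F @` `[0%R, 1%R]) <= m%:R%:E)%E.
Proof.
move=> delta0 ph Fh.
have /choice[S HS] : forall i, exists S : (set R)^nat,
    [/\ forall j, measurable (S j), trivIset setT S,
        \bigcup_j S j = `[0, 1]%classic
      & forall j, strictly_monotone_on (S j) (h i)].
  by move=> i; have [] := ph i.
pose T k := `[0, 1]%classic `&` refinement R m S k.
have T01 k : T k `<=` `[0, 1]%classic by move=> x [].
have mT k : measurable (T k).
  apply: measurableI => //; apply: measurable_refinement => i j.
  by have [] := HS i.
have tT : trivIset setT T.
  by apply: trivIset_setIl; apply: trivIset_refinement => i; have [] := HS i.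
have TS i k : strictly_monotone_on (T k) (h i).
  (* An empty T k need not lie in any S i j, but is trivially monotone. *)
  have [[x [_ [g [gk Sg]]]]|T0] := pselect (exists x, T k x); last first.
    by left=> x y Tx; exfalso; apply: T0; exists x.
  have [_ _ _ mS] := HS i; apply: strictly_monotone_onS (mS (g i)) => y [_ Ty].
  have Tx : refinement R m S k x by exists g.
  have [j [Sx Sy]] := refinement_same _ _ _ _ _ _ i Tx Ty.
  suff -> : g i = j by [].
  by have [_ tS _ _] := HS i; apply: tS => //; exists x; split=> //; exact: Sg.
have mhT i k : measurable (h i @` T k).
  apply: measurable_image_monotone => //.
  by have [_ _ mh _] := ph i; apply: measurable_funS mh.
have hT01 i k : h i @` T k `<=` `[0, 1]%classic.
  by have [h01 _ _ _] := ph i; move=> _ [x /T01 x01 <-]; exact: h01.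
have m01 : lebesgue_measure (`[0, 1]%classic : set R) = 1%:E.
  by rewrite lebesgue_measure_itv/= lte_fin ltr01 oppr0 adde0.
have mbhT i : measurable (\bigcup_k h i @` T k).
  by apply: bigcup_measurable => k _; exact: mhT.
have thT i : trivIset setT (fun k => h i @` T k).
  move=> k l _ _ [y [[a Ta <-] [b Tb hab]]]; apply: tT => //; exists a; split=> //.
  have [_ hinj _ _] := ph i.
  by rewrite -(hinj b a _ _ hab)// inE; [exact: T01 Tb|exact: T01 Ta].
have -> : F @` `[0, 1] = \bigcup_k F @` T k.
  apply/seteqP; split=> [_ [x x01 <-]|_ [k _ [x /T01 x01 <-]]]; last by exists x.
  have [k Sk] : exists k, refinement R m S k x.
    apply: refinement_cover => i; have [_ _ Su _] := HS i.
    by move: x01; rewrite -Su => -[j _ Sj]; exists j.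
  by exists k => //; exists x.
apply: le_trans (hausdorff_delta_sigma_subadditive _ _ _ _ _) _.
apply: (@le_trans _ _ (\sum_(0 <= k <oo) \sum_i lebesgue_measure (h i @` T k))%E).
  apply: lee_nneseries => k; first by move=> _ _; exact: hausdorff_delta_ge0.
  move=> _; apply: hausdorff_delta_monotone_graph => // i.
  apply: (@le_lt_trans _ _ 1%:E); last exact: ltry.
  by rewrite -m01; apply: le_measure; rewrite ?inE//; exact: mhT.
rewrite nneseries_sum//.
apply: (@le_trans _ _ (\sum_(i < m) 1%:E)%E); last first.
  by rewrite sumEFin sumr_const card_ord.
apply: lee_sum => i _.
rewrite -measure_semi_bigcup//; [|exact: mhT|exact: mbhT].
rewrite -m01; apply: le_measure; rewrite ?inE//; first exact: mbhT.
by move=> x [k _ hx]; exact: hT01 hx.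
Qed.

(** * Graphs of piecewise monotone functions *)

Lemma edist_le_l1_dist (R : realType) (n : nat) (x y : 'rV[R]_n) :
  Defs.edist x y <= \sum_(i < n) `|x ord0 i - y ord0 i|.
Proof.
(* Nonnegativity of the second sum is needed to drop the cross terms. *)
pose Q (a b : R) := 0 <= b /\ a <= b ^+ 2.
have [S0 le_sqr] : Q (\sum_(i < n) (x ord0 i - y ord0 i) ^+ 2)
    (\sum_(i < n) `|x ord0 i - y ord0 i|).
  apply: (big_ind2 Q).
  - by rewrite /Q expr0n.
  - move=> a b c d [b0 ab] [d0 cd]; split; first exact: addr_ge0.
    apply: le_trans (lerD ab cd) _.
    by rewrite sqrrD -addrA lerD2l lerDr mulrn_wge0// mulr_ge0.
  - by move=> i _; split=> //; rewrite real_normK// num_real.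
rewrite /Defs.edist -[leRHS]ger0_norm// -sqrtr_sqr.
by rewrite ler_wsqrtr.
Qed.

(** The coordinate alpha is constant and does not contribute to distances, which
leaves n - 1 functions. *)
Lemma hausdorff_delta_graph_point (R : realType) (n : nat) (f : nat -> R -> R)
    (alpha delta : R) :
  (2 <= n)%N -> 0 < delta ->
  (forall i : nat, (1 <= i <= n - 2)%N -> piecewise_monotone_fun (f i)) ->
  (hausdorff_delta 1 delta [set graph_point n f alpha x | x in `[0%R, 1%R]%classic]
     <= (n%:R - 1)%:E)%E.
Proof.
case: n => [//|m] m1 delta0 pf.
rewrite -natr1 addrK.
pose h (i : 'I_m) := if i == 0 :> nat then @id R else f i.
apply: (hausdorff_delta_piecewise_monotone _ _ _ _ h) => //.
  move=> i; rewrite /h; have [_|i0] := eqVneq (i : nat) 0%N.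
    exact: piecewise_monotone_id.
  apply: pf; rewrite lt0n i0/= subSS -ltnS subn1 prednK ?ltn_ord//.
move=> x y; apply: le_trans (edist_le_l1_dist _ _ _ _) _.
rewrite big_ord_recr/= !mxE/= eqxx.
have -> : (m == 0)%N = false by case: (m) m1.
rewrite subrr normr0 addr0; apply: ler_sum => i _.
rewrite !mxE/= (ltn_eqF (ltn_ord i)) /h.
by case: ifP.
Qed.

Theorem theorem1p4 (R : realType) (n : nat) (hn : (2 <= n)%N)
    (A : set 'rV[R]_n) (hA : dBE_set A) (hmono : piecewise_monotone_set A) :
  (hausdorff_dim A <= 1%:E)%E /\
  (hausdorff_measure 1 A <= (n%:R - 1)%:E)%E.
Proof.
have [f [alpha [_ pf ->]]] := hmono.
have bound delta := hausdorff_delta_graph_point R n f alpha delta hn ^~ pf.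
split.
  apply: (hausdorff_dim_le1 _ _ (n%:R - 1)) bound.
  by rewrite subr_ge0 ler1n ltnW.
rewrite hausdorff_measureE; apply: ge_ereal_sup => _ [d + <-].
by rewrite /= in_itv/= andbT; exact: bound.
Qed.
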